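(* Let $(\mathfrak{h},.)$ be a (finite-dimensional real) left-symmetric algebra. The symplectic cotangent Lie algebra $(\mathfrak{h}^\ast\times_{\ell}\mathfrak{h},\omega)$ is a symplectic Novikov Lie algebra (SNLA) if and only if $(\mathfrak{h},.)$ is a Novikov associative algebra, i.e. $(x.y).z=(x.z).y$ and $(x.y).z=x.(y.z)$ for all $x,y,z\in\mathfrak{h}$.
   Context: A left-symmetric algebra is a finite-dimensional real algebra $(\mathfrak{h},.)$ with $(x.y).z-x.(y.z)=(y.x).z-y.(x.z)$ for all $x,y,z$; then $[x,y]=x.y-y.x$ is a Lie bracket on $\mathfrak{h}$. For $x\in\mathfrak{h}$ let $\ell_x y=x.y$, and let $\ell_x^t:\mathfrak{h}^*\to\mathfrak{h}^*$ be its dual map, $\ell_x^t\alpha=\alpha\circ\ell_x$. The symplectic cotangent Lie algebra $(\mathfrak{h}^\ast\times_{\ell}\mathfrak{h},\omega)$ is the vector space $\mathfrak{h}^*\times\mathfrak{h}$ with the Lie bracket $[(\alpha,x),(\beta,y)]=(\ell_y^t\alpha-\ell_x^t\beta,[x,y])$ and the symplectic form $\omega((\alpha,x),(\beta,y))=\beta(x)-\alpha(y)$, for $x,y\in\mathfrak{h}$, $\alpha,\beta\in\mathfrak{h}^*$. A symplectic Lie algebra $(\mathfrak{g},\omega)$ is a finite-dimensional real Lie algebra with a skew-symmetric non-degenerate bilinear form $\omega$ satisfying $\omega([x,y],z)+\omega([y,z],x)+\omega([z,x],y)=0$. The left-symmetric product associated with $(\mathfrak{g},\omega)$ is the bilinear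 product $\cdot$ defined by $\omega(x\cdot y,z)=-\omega(y,[x,z])$; it is known to be left-symmetric with $x\cdot y-y\cdot x=[x,y]$. $(\mathfrak{g},\omega)$ is an SNLA if this product satisfies $(x\cdot y)\cdot z=(x\cdot z)\cdot y$ for all $x,y,z\in\mathfrak{g}$. *)

(* Defs.v *)
From HB Require Import structures.
From mathcomp Require Import all_boot all_algebra ring.
From mathcomp Require Import boolp reals.

Set Implicit Arguments.
Unset Strict Implicit.
Unset Printing Implicit Defensive.

Import GRing.Theory Num.Theory.
Local Open Scope ring_scope.

Definition left_symmetric (V : zmodType) (m : V -> V -> V) : Prop :=
  forall x y z, m (m x y) z - m x (m y z) = m (m y x) z - m y (m x z).

Definition jacobi (V : zmodType) (b : V -> V -> V) : Prop :=
  forall x y z, b x (b y z) + b y (b z x) + b z (b x y) = 0.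

Definition skew_form (K : zmodType) (V : Type) (w : V -> V -> K) : Prop :=
  forall x y, w x y = - w y x.

Definition nondegenerate_form (K V : zmodType) (w : V -> V -> K) : Prop :=
  forall x, (forall y, w x y = 0) -> x = 0.

Definition closed_form (K V : zmodType) (b : V -> V -> V) (w : V -> V -> K) :
  Prop := forall x y z, w (b x y) z + w (b y z) x + w (b z x) y = 0.

Record leftSymAlg (R : realType) := LeftSymAlg {
  lsa_sort :> vectType R;
  lsa_mul : {bilinear lsa_sort -> lsa_sort -> lsa_sort};
  lsa_mulP : left_symmetric lsa_mul }.

Record lieAlg (R : realType) := LieAlg {
  lie_sort :> vectType R;
  lie_bracket : {bilinear lie_sort -> lie_sort -> lie_sort};
  lie_bracketxx : forall x, lie_bracket x x = 0;
  lie_jacobi : jacobi lie_bracket }.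

Record symplecticLieAlg (R : realType) := SymplecticLieAlg {
  sla_lie :> lieAlg R;
  sla_form : {biscalar sla_lie};
  sla_form_skew : skew_form sla_form;
  sla_form_nondegenerate : nondegenerate_form sla_form;
  sla_form_closed : closed_form (@lie_bracket R sla_lie) sla_form }.

Section SymplecticProduct.
Variables (R : realType) (g : symplecticLieAlg R).
Local Notation w := (@sla_form R g).
Local Notation br := (@lie_bracket R g).

Let toDual (x : g) : 'Hom(g, R^o) := linfun (w x : g -> R^o).

Let toDualE x y : toDual x y = w x y.
Proof.
have linw : linear (w x : g -> R^o) by move=> a u v; rewrite linearPr.
pose L := GRing.isLinear.Build R g R^o *:%R (w x : g -> R^o) linw.
pose f : {linear g -> R^o} := HB.pack (w x : g -> R^o) L.
exact: (lfunE f).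
Qed.

Let toDual_linear : linear toDual.
Proof.
by move=> a x y; apply/lfunP=> z; rewrite add_lfunE scale_lfunE !toDualE linearPl.
Qed.

Lemma sla_representable (f : 'Hom(g, R^o)) : exists u, forall z, w u z = f z.
Proof.
pose L := GRing.isLinear.Build R g 'Hom(g, R^o) *:%R toDual toDual_linear.
pose T : {linear g -> 'Hom(g, R^o)} := HB.pack toDual L.
have injT : lker (linfun T) == 0%VS.
  apply/lker0P => x y; rewrite !lfunE /= => Txy.
  apply/eqP; rewrite -subr_eq0; apply/eqP/(@sla_form_nondegenerate R g) => z.
  by rewrite linearBl -!toDualE Txy subrr.
have : f \in limg (linfun T).
  suff -> : limg (linfun T) = fullv by rewrite memvf.
  apply/eqP; rewrite eqEdim subvf limg_dim_eq; last by rewrite (eqP injT) capv0.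
  by rewrite !dimvf /dim /= muln1.
by case/memv_imgP => u _ ->; exists u => z; rewrite lfunE /= toDualE.
Qed.

Lemma sla_mul_ex x y : exists u, forall z, w u z = - w y (br x z).
Proof.
have linf : linear (fun z => - w y (br x z) : R^o).
  by move=> a u v; rewrite !linearPr /= opprD scalerN.
pose L := GRing.isLinear.Build R g R^o *:%R _ linf.
pose f : {linear g -> R^o} := HB.pack (fun z => - w y (br x z) : R^o) L.
have [u uP] := sla_representable (linfun f).
by exists u => z; rewrite uP lfunE.
Qed.

(* The product x . y characterized by w (x . y) z = - w y [x, z]; the value is
   unique by nondegeneracy, see [sla_mulP] and [sla_mul_uniq]. *)
Definition sla_mul (x y : g) : g := sval (cid (sla_mul_ex x y)).

Lemma sla_mulP x y z : w (sla_mul x y) z = - w y (br x z).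
Proof. by rewrite /sla_mul; case: cid. Qed.

Lemma sla_mul_uniq x y u : (forall z, w u z = - w y (br x z)) -> u = sla_mul x y.
Proof.
move=> uP; apply/eqP; rewrite -subr_eq0; apply/eqP.
by apply/(@sla_form_nondegenerate R g) => z; rewrite linearBl uP sla_mulP subrr.
Qed.

End SymplecticProduct.

Definition SNLA (R : realType) (g : symplecticLieAlg R) : Prop :=
  right_commutative (@sla_mul R g).

Definition novikov_associative (R : realType) (h : leftSymAlg R) : Prop :=
  right_commutative (@lsa_mul R h) /\ associative (@lsa_mul R h).

Section Cotangent.
Import VectorInternalTheory.
Variables (R : realType) (h : leftSymAlg R).
Local Notation m := (@lsa_mul R h).

Definition lsa_bracket (x y : h) : h := m x y - m y x.

Definition lsa_lmul_dual (x : h) (alpha : 'Hom(h, R^o)) : 'Hom(h, R^o) :=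
  (alpha \o linfun (m x))%VF.

Definition cot_space : vectType R := ('Hom(h, R^o) * h)%type.

Definition cot_bracket (X Y : cot_space) : cot_space :=
  (lsa_lmul_dual Y.2 X.1 - lsa_lmul_dual X.2 Y.1, lsa_bracket X.2 Y.2).

Definition cot_form (X Y : cot_space) : R := Y.1 X.2 - X.1 Y.2.

Lemma lsa_lmul_dualE x alpha y : lsa_lmul_dual x alpha y = alpha (m x y).
Proof. by rewrite comp_lfunE lfunE. Qed.

Let homBE (f f' : 'Hom(h, R^o)) x : (f - f') x = f x - f' x.
Proof. by rewrite add_lfunE opp_lfunE. Qed.

Lemma cot_bracket_bilinear : bilinear_for *:%R *:%R cot_bracket.
Proof.
split=> [Y a X X'|X a Y Y']; congr (_, _) => /=; last 1 first.
- by rewrite /lsa_bracket linearPl linearPr scalerBr opprD addrACA.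
- apply/lfunP => z; rewrite homBE add_lfunE scale_lfunE !homBE !lsa_lmul_dualE.
  rewrite add_lfunE scale_lfunE linearPl linearP.
  by rewrite scalerBr opprD addrACA.
- by rewrite /lsa_bracket linearPl linearPr scalerBr opprD addrACA.
- apply/lfunP => z; rewrite homBE add_lfunE scale_lfunE !homBE !lsa_lmul_dualE.
  rewrite add_lfunE scale_lfunE linearPl linearP.
  by rewrite scalerBr opprD addrACA.
Qed.

HB.instance Definition _ := bilinear_isBilinear.Build R cot_space cot_space
  cot_space *:%R *:%R cot_bracket cot_bracket_bilinear.

Lemma cot_form_bilinear : bilinear_for *%R *%R cot_form.
Proof.
split=> [Y a X X'|X a Y Y']; rewrite /cot_form /= add_lfunE scale_lfunE linearP.
  by rewrite opprD addrACA -[a * _]/(a *: (_ : R^o)) scalerBr.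
by rewrite opprD addrACA -[a * _]/(a *: (_ : R^o)) scalerBr.
Qed.

HB.instance Definition _ := bilinear_isBilinear.Build R cot_space cot_space
  R *%R *%R cot_form cot_form_bilinear.

Lemma cot_bracketxx X : cot_bracket X X = 0.
Proof. by rewrite /cot_bracket /lsa_bracket !subrr. Qed.

Let mulAl x y z : m (m x y) z = m x (m y z) + m (m y x) z - m y (m x z).
Proof.
by apply/eqP; rewrite -addrA addrC -subr_eq; apply/eqP/(@lsa_mulP R h).
Qed.

Lemma cot_jacobi : jacobi cot_bracket.
Proof.
move=> [f x] [f' y] [f'' z]; congr (_, _) => /=.
  apply/lfunP => t.
  rewrite 2!add_lfunE !homBE !lsa_lmul_dualE !homBE !lsa_lmul_dualE zero_lfunE.
  rewrite /lsa_bracket !linearBl (mulAl y z) (mulAl z x) (mulAl x y).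
  rewrite !(linearB, linearD) /=.
  by rewrite -[0]/(0 : R); ring.
rewrite /lsa_bracket !(linearBl, linearBr).
rewrite (mulAl y z) (mulAl z x) (mulAl x y).
move: (m x (m y z)) (m x (m z y)) (m y (m x z)) (m y (m z x)) (m z (m x y))
  (m z (m y x)) (m (m y x) z) (m (m z y) x) (m (m x z) y) => a b c d e k p q r.
apply: v2r_inj; apply/rowP => i.
have vD u v : v2r (u + v) 0 i = v2r u 0 i + v2r v 0 i.
  by rewrite linearD mxE.
have vN u : v2r (- u) 0 i = - v2r u 0 i by rewrite linearN mxE.
have v0 : v2r (0 : h) 0 i = 0 by rewrite linear0 mxE.
by rewrite !(vD, vN) v0; ring.
Qed.

Lemma cot_form_skew : skew_form cot_form.
Proof. by move=> X Y; rewrite /cot_form opprB. Qed.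

Lemma cot_form_nondegenerate : nondegenerate_form cot_form.
Proof.
move=> [f x] w0; congr (_, _).
  apply/lfunP => y; move: (w0 (0, y)); rewrite /cot_form /= !zero_lfunE sub0r.
  by move/eqP; rewrite oppr_eq0 => /eqP.
have fx0 (f' : 'Hom(h, R^o)) : f' x = 0.
  by move: (w0 (f', 0)); rewrite /cot_form /= linear0 subr0.
apply: v2r_inj; apply/rowP => i; rewrite linear0 mxE.
have linf : linear (fun u : h => v2r u 0 i : R^o).
  by move=> a u v; rewrite linearP !mxE.
pose L := GRing.isLinear.Build R h R^o *:%R _ linf.
pose f' : {linear h -> R^o} := HB.pack (fun u : h => v2r u 0 i : R^o) L.
by have := fx0 (linfun f'); rewrite lfunE.
Qed.

Lemma cot_form_closed : closed_form cot_bracket cot_form.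
Proof.
move=> [f x] [f' y] [f'' z].
rewrite /cot_form /= !homBE !lsa_lmul_dualE /lsa_bracket !linearB /=.
ring.
Qed.

Definition cotangent_lie : lieAlg R := LieAlg cot_bracketxx cot_jacobi.

Definition cotangent : symplecticLieAlg R :=
  @SymplecticLieAlg R cotangent_lie cot_form
    cot_form_skew cot_form_nondegenerate cot_form_closed.

End Cotangent.

(* Main.v *)
Require Import Defs.
From mathcomp Require Import all_boot all_algebra.
From mathcomp Require Import boolp reals.
From mathcomp Require Import ring lra.

(** Pairing with test vectors gives
      (a, x) . (b, y) = (a o r_y + b o r_x - b o l_x, x.y),   r_y z = z.y.
    The h-component of the right commutativity of this product is the one of h.
    Its h^*-component amounts to z(xy) - (xy)z = (zy)x - x(zy), which, when h is
    right commutative, left symmetry turns into 2 (x(zy) - (xz)y) = 0. *)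

Set Implicit Arguments.
Unset Strict Implicit.
Unset Printing Implicit Defensive.

Import GRing.Theory Num.Theory.
Local Open Scope ring_scope.

Section CotangentProduct.
Variables (R : realType) (h : leftSymAlg R).
Local Notation m := (@lsa_mul R h).
Local Notation mul := (@sla_mul R (cotangent h)).

(** The vector [(0, u - v)] is [cot_form]-orthogonal to everything, so nondegeneracy kills it. *)
Lemma functional_eq (u v : h) : (forall f : 'Hom(h, R^o), f u = f v) -> u = v.
Proof.
move=> fuv; apply/eqP; rewrite -subr_eq0; apply/eqP.
have : (0, u - v) = 0 :> cot_space h; last by case.
apply: (@cot_form_nondegenerate R h) => -[f z].
by rewrite /cot_form /= linearB /= fuv subrr zero_lfunE subrr.
Qed.

(** The test vector [(f, z)] sees both components of the product; [z = 0] and [f = 0] then isolate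
    them. *)
Lemma cot_mulP (X Y : cotangent h) (f : 'Hom(h, R^o)) (z : h) :
  f (mul X Y).2 - (mul X Y).1 z =
    f (m X.2 Y.2) - (X.1 (m z Y.2) + Y.1 (m z X.2) - Y.1 (m X.2 z)).
Proof.
have := sla_mulP X Y ((f, z) : cotangent h).
rewrite /= /cot_form /= => ->.
rewrite add_lfunE opp_lfunE !lsa_lmul_dualE /lsa_bracket linearB /=.
by ring.
Qed.

Lemma cot_mul2 (X Y : cotangent h) : (mul X Y).2 = m X.2 Y.2.
Proof.
apply: functional_eq => f; have := cot_mulP X Y f 0.
by rewrite !(linear0, linear0l, addr0, subr0).
Qed.

Lemma cot_mul1 (X Y : cotangent h) (z : h) :
  (mul X Y).1 z = X.1 (m z Y.2) + Y.1 (m z X.2) - Y.1 (m X.2 z).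
Proof.
by have := cot_mulP X Y 0 z; rewrite !zero_lfunE !sub0r => /oppr_inj.
Qed.

Lemma cot_mul_mul1 (X Y Z : cotangent h) (z : h) :
  (mul (mul X Y) Z).1 z =
    X.1 (m (m z Z.2) Y.2) + Y.1 (m (m z Z.2) X.2 - m X.2 (m z Z.2))
    + Z.1 (m z (m X.2 Y.2) - m (m X.2 Y.2) z).
Proof. by rewrite !cot_mul1 !cot_mul2 !linearB /= !addrA. Qed.

(** Matches the functional of the third factor in [cot_mul_mul1] with its term after the last two
    factors are swapped. *)
Lemma novikov_associative_comm (x y z : h) : novikov_associative h ->
  m z (m x y) - m (m x y) z = m (m z y) x - m x (m z y).
Proof. by case=> rc assoc; rewrite !assoc (rc z y x) (rc x z y). Qed.

End CotangentProduct.

Theorem proposition2 (R : realType) (h : leftSymAlg R) :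
  SNLA (cotangent h) <-> novikov_associative h.
Proof.
split=> [nov|nov X Y Z].
  have rc : right_commutative (@lsa_mul R h).
    move=> x y z.
    have := congr1 snd (nov ((0, x) : cotangent h) (0, y) (0, z)).
    by rewrite !cot_mul2.
  split=> // x z y; apply: functional_eq => f.
  (* With [f] as the only nonzero functional, each side keeps a single term. *)
  have := congr1 (fun X : cot_space h => X.1 z)
    (nov ((0, x) : cotangent h) (0, y) (f, 0)).
  rewrite !cot_mul_mul1 /= !zero_lfunE !add0r addr0 !linearB /=.
  have := congr1 f (@lsa_mulP R h x z y).
  rewrite !linearB /= (rc z y x) (rc x y z) => ls E.
  (* [ls] and [E] give f((xz)y - x(zy)) as f((zx)y - z(xy)) and as its opposite. *)
  by move: ls E; lra.
rewrite [LHS]surjective_pairing [RHS]surjective_pairing; congr pair.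
  (* The [X.1] terms agree by right commutativity; the [Y.1] and [Z.1] terms trade places. *)
  by apply/lfunP => z; rewrite !cot_mul_mul1 !novikov_associative_comm // nov.1 addrAC.
by rewrite !cot_mul2 nov.1.
Qed.
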